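(* Let $(X,Y,A,f,h)$ satisfy the standing assumptions in the context. Suppose $\gamma>1$ is such that $h^*\circ A^*$ has $\gamma$-curvature relative to $\tilde f^*$ with constant $C^*$ (defined in the context), where $\tilde f(y)=f(-y)$. Let $(v_k,y_k,z_k)$, $k=0,1,2,\dots$, be the iterates generated by the generalized mirror descent algorithm for $\min_{x\in X}\{f(Ax)+h(x)\}$ (defined in the context), where $\alpha_0=1$ and for $k=1,2,\dots$ the step size $\alpha_k\in[0,1]$ is chosen by the line search $$\alpha_k\in\operatorname*{argmin}_{\alpha\in[0,1]}\bigl\{(1-\alpha)\,M_k+D_{h^*}(A^*(v_k-\alpha(z_k+v_k)),A^*v_k)\bigr\},$$ with $M_1=D_{h^*}(-A^*z_0,A^*v_0)$ and $M_{k+1}=(1-\alpha_k)M_k+D_{h^*}(A^*((1-\alpha_k)v_k-\alpha_kz_k),A^*v_k)$ for $k=1,2,\dots$. Then for all $k=1,2,\dots$ $$f(A\hat y_k)+h(\hat y_k)+f^*(-v_k)+h^*(A^*v_k)\le C^*\left(\frac{\gamma}{k+\gamma}\right)^{\gamma-1},$$ where $\hat y_k$ is either of the following: $\hat y_k=\sum_{i=0}^{k-1}\lambda_i^ky_i$, or $\hat y_k$ is an element of $\{y_0,\dots,y_{k-1}\}$ minimizing $f(Ay_i)+h(y_i)$.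
   Context: Setting. $X,Y$ are finite-dimensional real vector spaces with duals $X^*,Y^*$ and pairings $\langle\cdot,\cdot\rangle$; $A:X\to Y$ is linear with adjoint $A^*:Y^*\to X^*$; $f:Y\to\mathbb{R}\cup\{\infty\}$ and $h:X\to\mathbb{R}\cup\{\infty\}$ are proper closed convex functions with Fenchel conjugates $f^*:Y^*\to\mathbb{R}\cup\{\infty\}$, $h^*:X^*\to\mathbb{R}\cup\{\infty\}$. $\operatorname{dom}(\partial f)\subseteq Y$ and $\operatorname{dom}(\partial h^* )\subseteq X^*$ are the sets of points at which the respective subdifferential is nonempty. Single-valued oracles are fixed: for each $y\in\operatorname{dom}(\partial f)$, $\partial f(y)\in Y^*$ denotes one fixed chosen element of $\operatorname{argmax}_{v\in Y^*}\{\langle v,y\rangle-f^*(v)\}$ (the subdifferential of $f$ at $y$); for each $u\in\operatorname{dom}(\partial h^* )$, $\partial h^*(u)\in X$ denotes one fixed chosen element of $\operatorname{argmax}_{x\in X}\{\langle u,x\rangle-h(x)\}$ (the subdifferential of $h^*$ at $u$). Standing assumption: $-A^*\partial f(y)\in\operatorname{dom}(\partial h^* )$ for all $y\in\operatorname{dom}(\partial f)$, and $A\,\partial h^*(u)\in\operatorname{dom}(\partial f)$ for all $u\in\operatorname{dom}(\partial h^* )$. Generalized Bregman distance: $D_{h^*}(v,u)=h^*(v)-h^*(u)-\langle v-u,\partial h^*(u)\rangle$ for $u\in\operatorname{dom}(\partial h^* )$, $v\in\operatorname{dom}(h^* )$, with the chosen subgradient. Relative $\gamma$-curvature: with the subgradient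 oracle of $\tilde f^{**}=\tilde f$ given by $\partial\tilde f(w)=-\partial f(-w)$, the function $h^*\circ A^*$ has $\gamma$-curvature relative to $\tilde f^*$ with (finite) constant $C^*$ if for all $v\in Y^*$ with $A^*v\in\operatorname{dom}(\partial h^* )$ and all $y\in\operatorname{dom}(\partial f)$, with $z=\partial f(y)$, one has $D_{h^*}(A^*(v+\alpha(-z-v)),A^*v)\le C^*\alpha^\gamma/\gamma$ for all $\alpha\in[0,1]$. Generalized mirror descent algorithm: given $v_0\in Y^*$ with $A^*v_0\in\operatorname{dom}(\partial h^* )$, for $k=0,1,2,\dots$: $y_k:=\partial h^*(A^*v_k)$, $z_k:=\partial f(Ay_k)$, pick $\alpha_k\in[0,1]$, $v_{k+1}:=(1-\alpha_k)v_k-\alpha_kz_k$. The iterates are understood to be well defined, i.e. $A^*v_k\in\operatorname{dom}(\partial h^* )$ for all $k$. Weights: for $k=0,1,2,\dots$, $\lambda^{k+1}_k=\alpha_k$ and $\lambda^{k+1}_i=(1-\alpha_k)\lambda^k_i$ for $i=0,\dots,k-1$. *)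

(* Defs.v *)
From mathcomp Require Export all_boot all_order all_algebra.
From mathcomp Require Export all_classical all_reals all_analysis.
Import Order.TTheory GRing.Theory Num.Theory.
Import numFieldNormedType.Exports.

Set Implicit Arguments.
Unset Strict Implicit.
Unset Printing Implicit Defensive.

Local Open Scope classical_set_scope.
Local Open Scope ring_scope.
Local Open Scope ereal_scope.

(* The dual of a finite-dimensional real vector space V : vectType R is
   'Hom(V, R^o); the pairing <u, x> is the application u x. Functions with
   values in the reals extended by +oo are functions to \bar R that never take
   the value -oo. *)

Section ConvexAnalysis.
Context {R : realType}.

Definition argmin (T : Type) (D : set T) (F : T -> \bar R) : set T :=
  [set t | D t /\ forall s, D s -> F t <= F s].

Definition argmax (T : Type) (D : set T) (F : T -> \bar R) : set T :=
  [set t | D t /\ forall s, D s -> F s <= F t].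

Section OneSpace.
Context {V : vectType R}.
Implicit Types g : V -> \bar R.

Definition proper_fun g : Prop :=
  (forall x, g x != -oo) /\ (exists x, g x != +oo).

(* Since proper functions avoid -oo, the right-hand side never has the form
   +oo - oo; at t = 0 and t = 1 it uses 0 * +oo = 0. *)
Definition convex_fun g : Prop :=
  forall (x y : V) (t : R), (0 <= t <= 1)%R ->
    g ((1 - t) *: x + t *: y)%R <= (1 - t)%:E * g x + t%:E * g y.

(* Lower semicontinuity for the canonical topology of V, read in the
   coordinates r2v : 'rV[R]_(dim V) -> V; any other linear coordinate system
   gives the same notion. *)
Definition closed_fun g : Prop :=
  lower_semicontinuous (fun r : 'rV[R]_(dim V) =>
    g (VectorInternalTheory.r2v r)).

Definition proper_closed_convex g : Prop :=
  [/\ proper_fun g, closed_fun g & convex_fun g].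

Definition fenchel g (u : 'Hom(V, R^o)) : \bar R :=
  ereal_sup (range (fun x : V => (u x : R)%:E - g x)).

Definition subdiff g (y : V) : set 'Hom(V, R^o) :=
  argmax setT (fun u : 'Hom(V, R^o) => (u y : R)%:E - fenchel g u).

(* The subdifferential of the conjugate g^*, as a subset of V. *)
Definition subdiff_fenchel g (u : 'Hom(V, R^o)) : set V :=
  argmax setT (fun x : V => (u x : R)%:E - g x).

Definition dom_subdiff g : set V := [set y | subdiff g y !=set0].

Definition dom_subdiff_fenchel g : set 'Hom(V, R^o) :=
  [set u | subdiff_fenchel g u !=set0].

(* The generalized Bregman distance D_{g^*}(v, u) for the subgradient selection
   dg' of g^*. It is meant for u in dom_subdiff_fenchel g and
   fenchel g v < +oo, where it is finite. *)
Definition bregman_fenchel g (dg' : 'Hom(V, R^o) -> V)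
    (v u : 'Hom(V, R^o)) : \bar R :=
  fenchel g v - fenchel g u - ((v - u)%R (dg' u) : R)%:E.

End OneSpace.

Section TwoSpaces.
Context {X Y : vectType R}.

Definition adjoint (A : 'Hom(X, Y)) (u : 'Hom(Y, R^o)) : 'Hom(X, R^o) :=
  (u \o A)%VF.

(* h^* \o A^* has gamma-curvature with constant C relative to the conjugate of
   y |-> f (- y). In terms of the oracle w |-> - df (- w) of the latter
   function, - df y is the oracle's answer at - y. *)
Definition relative_curvature (A : 'Hom(X, Y)) (f : Y -> \bar R)
    (h : X -> \bar R) (df : Y -> 'Hom(Y, R^o)) (dh' : 'Hom(X, R^o) -> X)
    (gamma C : R) : Prop :=
  forall v : 'Hom(Y, R^o), dom_subdiff_fenchel h (adjoint A v) ->
  forall y : Y, dom_subdiff f y ->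
  forall alpha : R, (0 <= alpha <= 1)%R ->
    bregman_fenchel h dh'
      (adjoint A (v + alpha *: (- df y - v))%R) (adjoint A v)
    <= (C * alpha `^ gamma / gamma)%:E.

Record mirror_descent (A : 'Hom(X, Y)) (h : X -> \bar R)
    (df : Y -> 'Hom(Y, R^o)) (dh' : 'Hom(X, R^o) -> X)
    (alpha : nat -> R) (v : nat -> 'Hom(Y, R^o)) (y : nat -> X)
    (z : nat -> 'Hom(Y, R^o)) : Prop := MirrorDescent {
  md_dom : forall k, dom_subdiff_fenchel h (adjoint A (v k));
  md_y : forall k, y k = dh' (adjoint A (v k));
  md_z : forall k, z k = df (A (y k));
  md_alpha : forall k, (0 <= alpha k <= 1)%R;
  md_v : forall k, v k.+1 = ((1 - alpha k) *: v k - alpha k *: z k)%R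
}.

End TwoSpaces.

(* weight alpha k i is lambda^k_i for i < k, and 0 for i >= k. *)
Fixpoint weight (alpha : nat -> R) (k i : nat) : R :=
  if k is k'.+1 then
    if i == k' then alpha k' else ((1 - alpha k') * weight alpha k' i)%R
  else 0%R.

End ConvexAnalysis.

(* Main.v *)
From HB Require Import structures.
From mathcomp Require Import ring lra.
Require Import Defs.
Import Order.TTheory GRing.Theory Num.Theory.
Import numFieldNormedType.Exports VectorInternalTheory.
Local Open Scope classical_set_scope.
Local Open Scope ring_scope.
Local Open Scope ereal_scope.

(* Write F(x) = f(Ax) + h(x) and let gap_k be the lambda^k-average of F(y_i),
   i < k, plus the average of f^*(z_i), plus h^*(A^* v_k). The Fenchel-Young
   equalities for y_k (with h) and for z_k (with f) give the exact recursion
   gap_(k+1) = (1 - alpha_k) gap_k + D(A^* v_(k+1), A^* v_k), D the Bregman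
   distance of h^*, so gap_k is M_k; as - v_k is the average of the z_i, Jensen's
   inequality bounds the left side of the claim by gap_k for both choices of
   yhat. The line search may be compared with the step t = gamma / (k + gamma),
   which gives the rate.

   The equality f(y) + f^*(z) = <z, y> for a maximizer z of <., y> - f^* amounts
   to f^** = f, which is proved by projecting a point below the graph of f on
   the epigraph of f. *)

Lemma convex_fun_le (R : realType) (V : vectType R) (g : V -> \bar R) (x y : V)
  (a b t : R) : convex_fun g ->
  (0 <= t <= 1)%R -> g x <= a%:E -> g y <= b%:E ->
  g ((1 - t) *: x + t *: y)%R <= ((1 - t) * a + t * b)%:E.
Proof.
move=> cg t01 gx gy; apply: le_trans (cg _ _ _ t01) _.
rewrite (EFinD (_ * _)) !EFinM.
by case/andP: t01 => t0 t1; apply: leeD; apply: lee_wpmul2l => //;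
  rewrite lee_fin ?subr_ge0.
Qed.

(** * Affine minorants of closed convex functions in coordinates *)

Section RowVectors.
Context {R : realType} {n : nat}.
Implicit Types (x y : 'rV[R]_n) (g : 'rV[R]_n -> \bar R).

Definition dotr x y : R := (\sum_i x ord0 i * y ord0 i)%R.

Lemma dotrC x y : dotr x y = dotr y x.
Proof. by apply: eq_bigr => i _; rewrite mulrC. Qed.

Lemma dotrDl x x' y : dotr (x + x') y = (dotr x y + dotr x' y)%R.
Proof. by rewrite -big_split; apply: eq_bigr => i _; rewrite mxE mulrDl. Qed.

Lemma dotrZl (a : R) x y : dotr (a *: x) y = (a * dotr x y)%R.
Proof. by rewrite mulr_sumr; apply: eq_bigr => i _; rewrite mxE mulrA. Qed.

Lemma dotrDr x y y' : dotr x (y + y') = (dotr x y + dotr x y')%R.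
Proof. by rewrite dotrC dotrDl !(dotrC x). Qed.

Lemma dotrZr (a : R) x y : dotr x (a *: y) = (a * dotr x y)%R.
Proof. by rewrite dotrC dotrZl dotrC. Qed.

Lemma dotrNl x y : dotr (- x) y = (- dotr x y)%R.
Proof. by rewrite -scaleN1r dotrZl mulN1r. Qed.

Lemma dotrNr x y : dotr x (- y) = (- dotr x y)%R.
Proof. by rewrite -scaleN1r dotrZr mulN1r. Qed.

Lemma dotr0 x : dotr x 0%R = 0%R.
Proof. by rewrite -(scale0r x) dotrZr mul0r. Qed.

Definition dotrE := (dotrDl, dotrDr, dotrNl, dotrNr, dotrZl, dotrZr).

Lemma sqr_le_dotr x i : (x ord0 i ^+ 2 <= dotr x x)%R.
Proof.
rewrite /dotr (bigD1 i) //= expr2 lerDl sumr_ge0 // => j _.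
by rewrite -expr2 sqr_ge0.
Qed.

Lemma dotr_ge0 x : (0 <= dotr x x)%R.
Proof. by apply: sumr_ge0 => i _; rewrite -expr2 sqr_ge0. Qed.

Lemma dotr_le0 x : (dotr x x <= 0)%R -> x = 0%R.
Proof.
move=> x0; apply/rowP => i; rewrite mxE; apply/eqP; rewrite -sqrf_eq0 eq_le.
by rewrite sqr_ge0 (le_trans (sqr_le_dotr x i)).
Qed.

Lemma continuous_sqdist y (r : R) : continuous (fun w : 'rV[R]_n * R =>
  dotr (w.1 - y) (w.1 - y) + (w.2 - r) ^+ 2)%R.
Proof.
move=> w; apply: cvgD.
  apply: cvg_big => [|i _]; first exact: add_continuous.
  have H : (fun x : 'rV[R]_n * R => (x.1 - y)%R ord0 i) @ w -->
      (w.1 - y)%R ord0 i.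
    rewrite !mxE; under eq_fun do rewrite !mxE.
    apply: cvgB; last exact: cvg_cst.
    apply: (@cvg_comp _ _ _ fst (fun x : 'rV[R]_n => x ord0 i)); last first.
      exact: coord_continuous.
    exact: cvg_fst.
  exact: cvgM.
rewrite expr2; under eq_fun do rewrite expr2.
by apply: cvgM; (apply: cvgB; [exact: cvg_snd|exact: cvg_cst]).
Qed.

Lemma closed_epigraph g : lower_semicontinuous g ->
  closed [set w : 'rV[R]_n * R | g w.1 <= w.2%:E].
Proof.
move=> lscg [x s] /= cls; rewrite leNgt; apply/negP => sg.
(* A level strictly between s and g x separates (x, s) from the epigraph: lower semicontinuity keeps
   g above it near x. *)
have [a sa ag] : exists2 a : R, (s < a)%R & a%:E < g x.
  case: (g x) sg => [b||] //.
    rewrite lte_fin => sb; exists ((s + b) / 2)%R; first by lra.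
    by rewrite lte_fin; lra.
  by move=> _; exists (s + 1)%R; [lra|rewrite ltry].
have [U xU Ug] := lscg _ _ ag.
have : nbhs (x, s) (U `*` [set t : R | (t < a)%R]).
  exists (U, [set t : R | (t < a)%R]) => //=; split => //=.
  exact: lt_nbhsl.
move=> /cls[[x' t] [/= gt [/Ug ag' ta]]].
have := lt_le_trans ag' gt; rewrite lte_fin => at'.
by move: (lt_trans at' ta); rewrite ltxx.
Qed.

Lemma exists_nearest_epigraph g y (r : R) : lower_semicontinuous g ->
  (exists x t, g x <= t%:E) ->
  exists p s, g p <= s%:E /\ forall x t, g x <= t%:E ->
    (dotr (p - y) (p - y) + (s - r) ^+ 2 <=
     dotr (x - y) (x - y) + (t - r) ^+ 2)%R.
Proof.
move=> lscg [x0 [t0 gx0]].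
pose dist (w : 'rV[R]_n * R) :=
  (dotr (w.1 - y) (w.1 - y) + (w.2 - r) ^+ 2)%R.
(* A bound without square roots: c^2 <= d implies |c| <= d + 1. Points outside the box [K] are thus
   farther from (y, r) than (x0, t0), so minimizing over the compact part of the epigraph in [K]
   suffices. *)
pose b := (dist (x0, t0) + 1)%R.
have d0 : (0 <= dist (x0, t0))%R by rewrite addr_ge0 ?dotr_ge0 ?sqr_ge0.
pose K := [set x : 'rV[R]_n |
    forall i, `[(y ord0 i - b)%R, (y ord0 i + b)%R]%classic (x ord0 i)] `*`
    `[(r - b)%R, (r + b)%R]%classic.
have KP w : (dist w <= dist (x0, t0))%R -> K w.
  have sqr_le (c : R) : (c ^+ 2 <= dist (x0, t0) -> - b <= c <= b)%R.
    by move=> ?; rewrite /b; apply/andP; split; nra.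
  move=> ww; split=> /=.
    move=> i; rewrite in_itv/=.
    have /sqr_le : ((w.1 ord0 i - y ord0 i) ^+ 2 <= dist (x0, t0))%R.
      apply: le_trans ww; have := sqr_le_dotr (w.1 - y)%R i.
      by rewrite !mxE => /le_trans; apply; rewrite lerDl sqr_ge0.
    by move=> /andP[? ?]; apply/andP; split; lra.
  have /sqr_le : ((w.2 - r) ^+ 2 <= dist (x0, t0))%R.
    by apply: le_trans ww; rewrite lerDr dotr_ge0.
  by rewrite in_itv/= => /andP[? ?]; apply/andP; split; lra.
pose E := [set w : 'rV[R]_n * R | g w.1 <= w.2%:E].
have cKE : compact (K `&` E).
  apply: compact_closedI; last exact: closed_epigraph.
  apply: compact_setX; last exact: segment_compact.
  apply: (@rV_compact _ _ (fun i => `[(y ord0 i - b)%R, (y ord0 i + b)%R]%classic)).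
  by move=> i; exact: segment_compact.
have KE0 : K `&` E !=set0 by exists (x0, t0); split => //; apply: KP.
have [|[p s]] := compact_EVT_min (f := dist) KE0 cKE.
  by apply: continuous_subspaceT; exact: continuous_sqdist.
rewrite inE => -[_ Eps] min; exists p, s; split => // x t gxt.
have [xx0|/ltW x0x] := leP (dist (x, t)) (dist (x0, t0)).
  by apply: (min (x, t)); rewrite inE; split => //; exact: KP.
by apply: le_trans x0x; apply: min; rewrite inE; split => //; exact: KP.
Qed.

(** If a < 0, then th = - a / (q - a) lies in [0, 1] and turns the quadratic into th^2 (2 a - q) <
    0. This converts minimality along a segment into a first-order inequality. *)
Lemma quadratic_slope_ge0 (a q : R) : (0 <= q)%R ->
  (forall th : R, 0 <= th <= 1 -> 0 <= 2 * th * a + th ^+ 2 * q)%R ->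
  (0 <= a)%R.
Proof.
move=> q0 H; rewrite leNgt; apply/negP => a0.
have den : (0 < q - a)%R by lra.
have th01 : (0 <= - a / (q - a) <= 1)%R.
  by rewrite ler_pdivrMr // divr_ge0; lra.
have := H _ th01; apply/negP; rewrite -ltNge.
have -> : (2 * (- a / (q - a)) * a + (- a / (q - a)) ^+ 2 * q =
    (- a / (q - a)) ^+ 2 * (2 * a - q))%R by field; lra.
by rewrite pmulr_rlt0; [lra|rewrite exprn_gt0 // divr_gt0 //; lra].
Qed.

(* (y - p, r - s) is an outward normal at (p, s) to the epigraph. *)
Lemma epigraph_normal g y (r : R) : lower_semicontinuous g -> convex_fun g ->
  (exists x t, g x <= t%:E) ->
  exists p s, [/\ g p <= s%:E, (r <= s)%R & forall x t, g x <= t%:E ->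
    (0 <= dotr (p - y) (x - p) + (s - r) * (t - s))%R].
Proof.
move=> lscg cg g0; have [p [s [gps min]]] := exists_nearest_epigraph g y r lscg g0.
have normal x t : g x <= t%:E ->
    (0 <= dotr (p - y) (x - p) + (s - r) * (t - s))%R.
  move=> gxt.
  apply: (quadratic_slope_ge0 _ (dotr (x - p) (x - p) + (t - s) ^+ 2)%R).
    by rewrite addr_ge0 ?dotr_ge0 ?sqr_ge0.
  (* Convexity puts the segment from (p, s) to (x, t) in the epigraph, so none of its points is
     closer to (y, r) than (p, s). *)
  move=> th th01; have := min _ _ (convex_fun_le _ _ _ _ _ _ _ _ cg th01 gps gxt).
  have -> : ((1 - th) *: p + th *: x - y = (p - y) + th *: (x - p))%R.
    by apply/rowP => i; rewrite !mxE; ring.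
  move: (p - y)%R (x - p)%R => u w.
  rewrite !dotrE (dotrC w u) -subr_ge0 => h; apply: le_trans h _.
  by rewrite le_eqVlt; apply/orP; left; apply/eqP; ring.
exists p, s; split => //.
(* Tested at (p, s + 1), the normal inequality reduces to 0 <= s - r. *)
have gps1 : g p <= (s + 1)%:E.
  by apply: le_trans gps _; rewrite lee_fin lerDl.
have := normal _ _ gps1.
by rewrite subrr dotr0 add0r addrAC subrr add0r mulr1 subr_ge0.
Qed.

(** Dividing the normal inequality by s - r > 0 gives the slope (y - p) / (s - r); the discarded
    terms |y - p|^2 and (s - r)^2 have the right sign. *)
Lemma nonvertical_normal_minorant g y p (r s : R) : (r < s)%R ->
  (forall x t, g x <= t%:E ->
    (0 <= dotr (p - y) (x - p) + (s - r) * (t - s))%R) ->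
  exists c, forall x t, g x <= t%:E -> (r + dotr c (x - y) <= t)%R.
Proof.
move=> rs normal; exists ((s - r)^-1 *: (y - p))%R => x t /normal.
have -> : (x - p = (x - y) + (y - p))%R by rewrite subrKA.
rewrite -(opprB y p); set u := (y - p)%R; set w := (x - y)%R.
rewrite dotrNl dotrDr dotrZl => h.
have u0 := dotr_ge0 u; have rs0 : (0 < s - r)%R by lra.
rewrite -lerBrDl ler_pdivrMl //; nra.
Qed.

(** A horizontal normal (s = r), tested at (y, b), would force p = y, and then g y <= s = r < b. *)
Lemma affine_minorant_dom g y (r b : R) : lower_semicontinuous g ->
  convex_fun g -> g y = b%:E -> (r < b)%R ->
  exists c, forall x t, g x <= t%:E -> (r + dotr c (x - y) <= t)%R.
Proof.
move=> lscg cg gy rb.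
have gyb : g y <= b%:E by rewrite gy.
have [|p [s [gps rs normal]]] := epigraph_normal g y r lscg cg.
  by exists y, b.
have [rs'|sr] := ltP r s; first exact: nonvertical_normal_minorant normal.
have sEr : s = r by lra.
have := normal _ _ gyb; rewrite sEr subrr mul0r addr0 -(opprB p y) dotrNr.
rewrite oppr_ge0 => /dotr_le0/eqP; rewrite subr_eq0 => /eqP py.
by move: gps; rewrite py gy sEr lee_fin leNgt rb.
Qed.

(** Outside the domain of g the normal can be horizontal. It then separates y from the domain, so a
    minorant obtained at a point x0 of the domain can be tilted. *)
Lemma affine_minorant g y (r : R) : lower_semicontinuous g ->
  convex_fun g -> proper_fun g -> r%:E < g y ->
  exists c, forall x t, g x <= t%:E -> (r + dotr c (x - y) <= t)%R.
Proof.
move=> lscg cg [gNoo [x0 gx0]] rgy.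
have [b gx0b] : exists b : R, g x0 = b%:E.
  by move: (gNoo x0) gx0; case: (g x0) => // b _ _; exists b.
have [|p [s [gps rs normal]]] := epigraph_normal g y r lscg cg.
  by exists x0, b; rewrite gx0b.
have [rs'|sr] := ltP r s; first exact: nonvertical_normal_minorant normal.
(* The normal is horizontal: tilt some affine minorant along it. *)
have sEr : s = r by lra.
have py : (0 < dotr (p - y) (p - y))%R.
  rewrite ltNge; apply/negP => /dotr_le0/eqP; rewrite subr_eq0 => /eqP py.
  by move: rgy; rewrite -py ltNge -sEr gps.
have [c minor] : exists c, forall x t, g x <= t%:E ->
    (b - 1 + dotr c (x - x0) <= t)%R.
  by apply: (affine_minorant_dom _ _ _ b) => //; lra.
(* [b'] is the value of the minorant at y. On the domain the horizontal normal gives <p - y, x - y>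
   >= |p - y|^2, so the tilt by [tau] lowers the minorant there by at least |r - b'|, which pays for
   replacing b' by r at y. *)
pose b' := (b - 1 + dotr c (y - x0))%R.
pose tau := (`|r - b'| / dotr (p - y) (p - y))%R.
have tau0 : (0 <= tau)%R by rewrite divr_ge0 // ltW.
have tauE : (tau * dotr (p - y) (p - y) = `|r - b'|)%R.
  by rewrite mulfVK // gt_eqF.
exists (c - tau *: (p - y))%R => x t gxt.
have := minor _ _ gxt; have := normal _ _ gxt.
rewrite sEr subrr mul0r addr0.
have -> : (x - p = (x - y) - (p - y))%R by rewrite opprB subrKA.
have -> : (x - x0 = (x - y) + (y - x0))%R by rewrite subrKA.
move: (ler_norm (r - b')) tauE; rewrite /b'.
move: (p - y)%R (x - y)%R (y - x0)%R => u w w0.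
rewrite !dotrE => h1 h2 h3 h4.
have := mulr_ge0 tau0 h3; lra.
Qed.
End RowVectors.

(** * Fenchel-Young equalities for both subgradient oracles *)

Section FenchelYoung.
Context {R : realType} {V : vectType R}.
Implicit Types (g : V -> \bar R) (x y : V) (u : 'Hom(V, R^o)).

Lemma row_functional (c : 'rV[R]_(dim V)) :
  exists u, forall x, u x = dotr c (v2r x).
Proof.
pose l := fun x : V => (dotr c (v2r x) : R^o).
have llin : linear l.
  by move=> a x x'; rewrite /l linearP dotrDr dotrZr.
pose L : {linear V -> R^o} := HB.pack l (GRing.isLinear.Build _ _ _ _ l llin).
by exists (linfun L) => x; rewrite lfunE.
Qed.

Lemma proper_closed_convex_minorant g y (r : R) : proper_closed_convex g ->
  r%:E < g y ->
  exists u, forall x (t : R), g x <= t%:E -> (r + (u (x - y)%R : R) <= t)%R.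
Proof.
move=> [[gNoo [x0 gx0]] clg cg] rgy.
pose G := fun w : 'rV[R]_(dim V) => g (r2v w).
have [c minor] : exists c, forall w t, G w <= t%:E ->
    (r + dotr c (w - v2r y) <= t)%R.
  apply: affine_minorant; rewrite ?/G ?v2rK //.
    by move=> w w' t t01; rewrite linearD !linearZ; exact: cg.
  by split=> [w|]; [exact: gNoo|exists (v2r x0); rewrite v2rK].
have [u uE] := row_functional c; exists u => x t gxt.
rewrite uE linearB; apply: minor.
by rewrite /G v2rK.
Qed.

Lemma fenchel_ge g u x (b : R) : g x = b%:E ->
  ((u x : R) - b)%:E <= fenchel g u.
Proof. by move=> gx; apply: ereal_sup_ubound; exists x => //; rewrite gx. Qed.

Lemma fenchel_gtNy g u : proper_fun g -> fenchel g u != -oo.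
Proof.
move=> [gNoo [x gx]]; have [b gxb] : exists b : R, g x = b%:E.
  by move: (gNoo x) gx; case: (g x) => // b _ _; exists b.
by rewrite gt_eqF // (lt_le_trans _ (fenchel_ge _ _ _ _ gxb)) ?ltNyr.
Qed.

(** One inequality is Fenchel-Young. For the other, each r below g y is the value at y of an affine
    minorant; its slope w has conjugate at most w y - r, so the maximality of u gives r <= u y -
    g^*(u). *)
Lemma subdiff_fenchel_young g y u : proper_closed_convex g ->
  subdiff g y u ->
  exists2 b : R, g y = b%:E & fenchel g u = ((u y : R) - b)%:E.
Proof.
move=> pcc [_ max]; have [pg _ _] := pcc.
have bi (r : R) : r%:E < g y -> r%:E <= (u y : R)%:E - fenchel g u.
  move=> /(proper_closed_convex_minorant _ _ _ pcc)[w minor].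
  apply: le_trans (max w I).
  suff : fenchel g w <= ((w y : R) - r)%:E.
    clear max minor; case: (fenchel g w) => [c| |] //=; last by rewrite leey.
    by rewrite -EFinB !lee_fin; lra.
  apply: ge_ereal_sup => _ [x _ <-].
  case gx: (g x) => [t| |] /=; [|by rewrite leNye|by move: (pg.1 x); rewrite gx].
  have := minor x t; rewrite gx lexx linearB /= => /(_ isT).
  by rewrite lee_fin; move: (w x) (w y) => p q; clear; lra.
move: (pg.1 y) (fenchel_gtNy _ u pg) (fenchel_ge g u y) bi.
case: (g y) => [b| |] // _; case: (fenchel g u) => [c| |] // _ young bi.
- exists b => //; congr EFin; have := young _ erefl; rewrite lee_fin => h1.
  apply/eqP; rewrite eq_le h1 andbT leNgt; apply/negP => h2.
  (* If b exceeded u y - c, their midpoint would be a level below g y violating [bi]. The remaining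
     cases refute infinite values in the same way. *)
  have := bi (((u y : R) - c + b) / 2)%R; rewrite lte_fin lee_fin.
  by move=> /(_ ltac:(lra)); lra.
- by have := bi (b - 1)%R; rewrite lte_fin => /(_ ltac:(lra)).
- by have := bi ((u y : R) - c + 1)%R (ltry _); rewrite lee_fin; lra.
- by have := bi 0%R (ltry _).
Qed.

(** The maximum runs over the primal variable, so x attains the supremum defining the conjugate; a
    point where g is finite excludes g x = +oo. *)
Lemma subdiff_fenchel_attained g u x : proper_fun g ->
  subdiff_fenchel g u x ->
  exists2 b : R, g x = b%:E & fenchel g u = ((u x : R) - b)%:E.
Proof.
move=> [gNoo [x0 gx0]] [_ max].
have fE : fenchel g u = (u x : R)%:E - g x.
  apply/eqP; rewrite eq_le; apply/andP; split.
    by apply: ge_ereal_sup => _ [x' _ <-]; exact: max.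
  by apply: ereal_sup_ubound; exists x.
move: (gNoo x) (max x0 I) fE; case: (g x) => [b| |] // _.
  by move=> _ ->; exists b.
by move: (gNoo x0) gx0; case: (g x0).
Qed.
End FenchelYoung.

(* Evaluation of functionals, with the operations of R^o read in R. *)
Section Evaluation.
Context {R : realType} {V : vectType R}.
Implicit Types (u w : 'Hom(V, R^o)) (x : V).

Lemma evalD u w x : ((u + w)%R x : R) = ((u x : R) + (w x : R))%R.
Proof. by rewrite add_lfunE. Qed.

Lemma evalN u x : ((- u)%R x : R) = (- (u x : R))%R.
Proof. by rewrite opp_lfunE. Qed.

Lemma evalZ (a : R) u x : ((a *: u)%R x : R) = (a * (u x : R))%R.
Proof. by rewrite scale_lfunE. Qed.
End Evaluation.

Lemma sum_weightS (R : realType) (V : lmodType R) (alpha : nat -> R)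
  (F : nat -> V) (k : nat) :
  (\sum_(i < k.+1) weight alpha k.+1 i *: F i =
   (1 - alpha k) *: (\sum_(i < k) weight alpha k i *: F i) + alpha k *: F k)%R.
Proof.
rewrite big_ord_recr /= eqxx; congr (_ + _)%R; rewrite scaler_sumr.
by apply: eq_bigr => i _; rewrite ltn_eqF // scalerA.
Qed.

(** * Jensen's inequality for the weights *)

Section Averages.
Context {R : realType} {V : vectType R}.
Implicit Types (g : V -> \bar R).

Lemma convex_fenchel g : proper_fun g -> convex_fun (fenchel g).
Proof.
move=> [gNoo _] u w t /andP[t0 t1]; apply: ge_ereal_sup => _ [x _ <-].
case gx: (g x) => [b| |] /=; [|by rewrite leNye|by move: (gNoo x); rewrite gx].
have -> : ((((1 - t) *: u + t *: w)%R x : R)%:E - b%:E =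
    (1 - t)%:E * ((u x : R) - b)%:E + t%:E * ((w x : R) - b)%:E).
  rewrite evalD !evalZ; move: (u x : R) (w x : R) => p q.
  by rewrite -!EFinM -EFinD; congr EFin; ring.
by apply: leeD; apply: lee_wpmul2l; rewrite ?lee_fin ?subr_ge0//;
  exact: fenchel_ge.
Qed.

(** By [sum_weightS] each average is a two-point convex combination of the previous one and a new
    point. Since alpha 0 = 1, the induction starts from the single point x 0 with weight 1. *)
Lemma jensen_weight g (alpha : nat -> R) (x : nat -> V) (a : nat -> R) k :
  convex_fun g -> (forall i, 0 <= alpha i <= 1)%R -> alpha 0%N = 1%R ->
  (1 <= k)%N -> (forall i, (i < k)%N -> g (x i) <= (a i)%:E) ->
  g (\sum_(i < k) weight alpha k i *: x i)%R <=
    (\sum_(i < k) weight alpha k i * a i)%:E.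
Proof.
move=> cg a01 a0; case: k => // k _; elim: k => [gxa|k IH gxa].
  by rewrite !big_ord1 /= a0 scale1r mul1r gxa.
rewrite sum_weightS (sum_weightS _ R^o); apply: convex_fun_le => //.
  by apply: IH => i ik; apply: gxa; exact: ltnW.
exact: gxa.
Qed.
End Averages.

(** * The convergence rate of the scalar recursion *)

(* With t = gamma / (k + gamma), the left-hand side is (k + 1) / (k + gamma)
   times C * t ^ (gamma - 1). *)
Lemma rate_step (R : realType) (gamma C k : R) : (1 < gamma)%R -> (0 <= C)%R ->
  (0 <= k)%R ->
  ((1 - gamma / (k + gamma)) * (C * (gamma / (k + gamma)) `^ (gamma - 1)) +
   C * (gamma / (k + gamma)) `^ gamma / gamma <=
   C * (gamma / (k + 1 + gamma)) `^ (gamma - 1))%R.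
Proof.
move=> g1 C0 k0; set n := (k + gamma)%R; have n0 : (0 < n)%R by rewrite /n; lra.
set t := (gamma / n)%R; have t0 : (0 < t)%R by rewrite divr_gt0 //; lra.
have n10 : (0 < n + 1)%R by lra.
have -> : (gamma / (k + 1 + gamma) = t * (n / (n + 1)))%R.
  rewrite /t (_ : k + 1 + gamma = n + 1)%R; last by rewrite /n; ring.
  by field; rewrite !gt_eqF.
have r0 : (0 < n / (n + 1))%R by rewrite divr_gt0.
have -> : (t `^ gamma = t * t `^ (gamma - 1))%R.
  rewrite -{1}(subrK 1 gamma)%R (@powRD _ _ (gamma - 1)%R 1%R); last first.
    by rewrite lt0r_neq0 ?implybT.
  by rewrite powRr1 ?ltW // mulrC.
rewrite powRM; [|exact: ltW|exact: ltW].
have q0 : (0 <= C * t `^ (gamma - 1))%R by rewrite mulr_ge0 // powR_ge0.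
set q := (t `^ _)%R in q0 *.
(* Factoring out C * q leaves 1 - (gamma - 1) / n <= (n / (n + 1)) ^ (gamma - 1). Both sides are
   compared with exp (- (gamma - 1) / n), the right one through ln (1 + 1 / n) <= 1 / n. *)
have -> : ((1 - t) * (C * q) + C * (t * q) / gamma =
    (1 - (gamma - 1) / n) * (C * q))%R.
  by rewrite /t; field; rewrite !gt_eqF //; lra.
rewrite [(C * (q * _))%R]mulrA [(C * q * _)%R]mulrC; apply: ler_wpM2r => //.
apply: le_trans (_ : expR (- ((gamma - 1) / n)) <= _)%R.
  exact: expR_ge1Dx.
rewrite /powR gt_eqF // ler_expR -mulrN ler_wpM2l //; first by lra.
have -> : (n / (n + 1) = (1 + n^-1)^-1)%R.
  by field; rewrite !gt_eqF.
have ni0 : (0 < n^-1)%R by rewrite invr_gt0.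
rewrite lnV ?posrE; last by lra.
by rewrite lerN2 le_ln1Dx //; lra.
Qed.

Lemma adjoint_eval (R : realType) (X Y : vectType R) (A : 'Hom(X, Y)) u x :
  adjoint A u x = u (A x).
Proof. by rewrite comp_lfunE. Qed.

Lemma adjointN (R : realType) (X Y : vectType R) (A : 'Hom(X, Y)) u :
  adjoint A (- u)%R = (- adjoint A u)%R.
Proof. by rewrite /adjoint comp_lfunNl. Qed.

Lemma rate_bound (R : realType) (gamma C : R) (m : nat -> R) :
  (1 < gamma)%R -> (0 <= m 1%N)%R -> (m 1%N <= C / gamma)%R ->
  (forall k (a : R), (1 <= k)%N -> 0 <= a <= 1 ->
    m k.+1 <= (1 - a) * m k + C * a `^ gamma / gamma)%R ->
  forall k, (1 <= k)%N ->
    (m k <= C * (gamma / (k%:R + gamma)) `^ (gamma - 1))%R.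
Proof.
move=> g1 m1_ge0 m1 mS; case=> // k _.
have g0 : (0 < gamma)%R by lra.
have C0 : (0 <= C)%R.
  by have := le_trans m1_ge0 m1; rewrite pmulr_lge0 ?invr_gt0.
elim: k => [|k IH].
  (* At k = 0 the step t is 1, so the left-hand side of [rate_step] is C / gamma. *)
  apply: le_trans m1 _; have := rate_step _ gamma C 0 g1 C0 (lexx 0%R).
  by rewrite !add0r divff ?gt_eqF // subrr mul0r add0r powR1 mulr1.
rewrite -natr1; apply: (le_trans _ (rate_step _ _ _ _ g1 C0 (ler0n _ k.+1))).
have kg : (0 < k.+1%:R + gamma)%R by rewrite ltr_wpDl.
have t01 : (0 <= gamma / (k.+1%:R + gamma) <= 1)%R.
  by rewrite divr_ge0 ?ler_pdivrMr ?mul1r ?lerDr ?ler0n // ltW.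
apply: le_trans (mS k.+1 _ isT t01) _; rewrite lerD2r.
by apply: ler_wpM2l => //; rewrite subr_ge0; case/andP: t01.
Qed.

(** * The gap recursion and the convergence theorem *)

Theorem proposition7 (R : realType) (X Y : vectType R) (A : 'Hom(X, Y))
  (f : Y -> \bar R) (h : X -> \bar R)
  (df : Y -> 'Hom(Y, R^o)) (dh' : 'Hom(X, R^o) -> X)
  (f_pcc : proper_closed_convex f) (h_pcc : proper_closed_convex h)
  (dfP : forall y, dom_subdiff f y -> subdiff f y (df y))
  (dh'P : forall u, dom_subdiff_fenchel h u -> subdiff_fenchel h u (dh' u))
  (df_dom : forall y, dom_subdiff f y ->
     dom_subdiff_fenchel h (- adjoint A (df y))%R)
  (dh'_dom : forall u, dom_subdiff_fenchel h u -> dom_subdiff f (A (dh' u)))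
  (gamma C : R) (gamma_gt1 : (1 < gamma)%R)
  (curv : relative_curvature A f h df dh' gamma C)
  (alpha : nat -> R) (v : nat -> 'Hom(Y, R^o)) (y : nat -> X)
  (z : nat -> 'Hom(Y, R^o))
  (iter : mirror_descent A h df dh' alpha v y z)
  (M : nat -> \bar R)
  (alpha0 : alpha 0%N = 1%R)
  (M1 : M 1%N =
     bregman_fenchel h dh' (- adjoint A (z 0%N))%R (adjoint A (v 0%N)))
  (MS : forall k, (1 <= k)%N ->
     M k.+1 = (1 - alpha k)%:E * M k +
       bregman_fenchel h dh'
         (adjoint A ((1 - alpha k) *: v k - alpha k *: z k)%R)
         (adjoint A (v k)))
  (line_search : forall k, (1 <= k)%N ->
     argmin `[0%R, 1%R]
       (fun a : R => (1 - a)%:E * M k +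
          bregman_fenchel h dh' (adjoint A (v k - a *: (z k + v k))%R)
            (adjoint A (v k)))
       (alpha k)) :
  forall (k : nat) (yhat : X), (1 <= k)%N ->
    yhat = (\sum_(i < k) weight alpha k i *: y i)%R \/
    argmin [set y i | i in [set i | (i < k)%N]]
      (fun x : X => f (A x) + h x) yhat ->
    f (A yhat) + h yhat + fenchel f (- v k)%R + fenchel h (adjoint A (v k))
      <= (C * (gamma / (k%:R + gamma)) `^ (gamma - 1))%:E.
Proof.
have [vdom yE zE a01 vS] := iter.
have [pf _ cf] := f_pcc; have [ph _ ch] := h_pcc.
(* Real representatives; the Fenchel-Young equalities below show that [fine] truncates no infinite
   value. *)
pose fy k := fine (f (A (y k))); pose hy k := fine (h (y k)).
pose fz k := fine (fenchel f (z k)).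
pose hv k := fine (fenchel h (adjoint A (v k))).
pose vA (i j : nat) : R := v i (A (y j)).
pose zA k : R := z k (A (y k)).
have ydom k : dom_subdiff f (A (y k)) by rewrite yE; exact: dh'_dom.
have [hyE hvE hv_val] : [/\ forall k, h (y k) = (hy k)%:E,
    forall k, fenchel h (adjoint A (v k)) = (hv k)%:E &
    forall k, hv k = (vA k k - hy k)%R].
  have H k : exists2 b : R, h (y k) = b%:E &
      fenchel h (adjoint A (v k)) = (vA k k - b)%:E.
    have := dh'P _ (vdom k); rewrite -yE.
    by move=> /(subdiff_fenchel_attained _ _ _ ph); rewrite adjoint_eval.
  by split=> k; have [b hb vb] := H k; rewrite /hy /hv ?hb ?vb.
have [fyE fzE fz_val] : [/\ forall k, f (A (y k)) = (fy k)%:E,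
    forall k, fenchel f (z k) = (fz k)%:E &
    forall k, fz k = (zA k - fy k)%R].
  have H k : exists2 b : R, f (A (y k)) = b%:E &
      fenchel f (z k) = (zA k - b)%:E.
    by have := dfP _ (ydom k); rewrite -zE; exact: subdiff_fenchel_young.
  by split=> k; have [b hb vb] := H k; rewrite /fy /fz ?hb ?vb.
pose d k : R := (hv k.+1 - hv k - (vA k.+1 k - vA k k))%R.
have dE k : bregman_fenchel h dh' (adjoint A (v k.+1)) (adjoint A (v k)) =
    (d k)%:E.
  by rewrite /bregman_fenchel !hvE -yE evalD evalN !adjoint_eval.
have vSA k : vA k.+1 k = ((1 - alpha k) * vA k k - alpha k * zA k)%R.
  by rewrite /vA vS evalD evalN !evalZ.
pose avg (a : nat -> R) k : R := (\sum_(i < k) weight alpha k i * a i)%R.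
have avgS a k : avg a k.+1 = ((1 - alpha k) * avg a k + alpha k * a k)%R.
  exact: (sum_weightS _ R^o).
pose gap k : R := (avg fy k + avg hy k + avg fz k + hv k)%R.
have gapS k : gap k.+1 = ((1 - alpha k) * gap k + d k)%R.
  (* With fz k = zA k - fy k and hv k = vA k k - hy k, the new values of f and h at y_k cancel. *)
  by rewrite /gap /d !avgS vSA fz_val !(hv_val k); ring.
have v1 : v 1%N = (- z 0%N)%R by rewrite vS alpha0 subrr scale0r sub0r scale1r.
(* The factor 1 - alpha 0 = 0 removes [gap 0], whose averages are empty sums. *)
have gap1 : gap 1%N = d 0%N by rewrite gapS alpha0 subrr mul0r add0r.
have ME k : (1 <= k)%N -> M k = (gap k)%:E.
  case: k => // k _; elim: k => [|k IH].
    by rewrite M1 -adjointN -v1 dE gap1.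
  by rewrite MS // -vS dE IH -EFinM -EFinD -gapS.
have gap_rate k : (1 <= k)%N ->
    (gap k <= C * (gamma / (k%:R + gamma)) `^ (gamma - 1))%R.
  apply: rate_bound => //.
  (* Nonnegativity of this Bregman distance is the Fenchel-Young inequality at v_1 and y_0. *)
  - rewrite gap1 /d -subr_ge0.
    have := fenchel_ge h (adjoint A (v 1%N)) (y 0%N) _ (hyE _).
    rewrite hvE lee_fin adjoint_eval -/(vA 1%N 0%N) (hv_val 0%N); lra.
  - rewrite -lee_fin gap1 -dE v1.
    have := curv _ (vdom 0%N) _ (ydom 0%N) 1%R; rewrite ler01 lexx -zE.
    by rewrite scale1r addrC subrK powR1 mulr1; exact.
  - move=> {}k a k1 a01'; rewrite -lee_fin (EFinD (_ * _)) (EFinM _ (gap k)) -!ME //.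
    (* The line search and the update of [M] write the same point in two forms; the curvature bound
       then applies to any competing step a. *)
    have lineE b : (v k - b *: (z k + v k) = (1 - b) *: v k - b *: z k)%R.
      by rewrite scalerDr opprD addrA scalerBl scale1r addrAC.
    have [_ min] := line_search _ k1; rewrite MS // -lineE.
    apply: le_trans (min a _) _; first by rewrite /= in_itv.
    rewrite leeD2l //; have := curv _ (vdom k) _ (ydom k) a a01'; rewrite -zE.
    by rewrite -opprD scalerN.
move=> k yhat k1 yhatP; apply: le_trans (_ : (gap k)%:E <= _); last first.
  by rewrite lee_fin gap_rate.
rewrite /gap !EFinD hvE leeD2r //; apply: leeD.
  case: yhatP => [->|[[i ik <-] min]].
    apply: leeD.
      rewrite linear_sum; under eq_bigr do rewrite linearZ.
      by apply: (jensen_weight f alpha (fun i => A (y i)) fy) => // i _; rewrite fyE.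
    by apply: (jensen_weight h alpha y hy) => // i _; rewrite hyE.
  (* The least value is at most the average: Jensen's inequality for the constant function F(y_i),
     with all points 0, encodes that the weights sum to 1. *)
  rewrite fyE hyE -!EFinD.
  have -> : (avg fy k + avg hy k =
      \sum_(j < k) weight alpha k j * (fy j + hy j))%R.
    by rewrite -big_split; apply: eq_bigr => j _; rewrite mulrDr.
  apply: (jensen_weight (V := R^o) (fun=> (fy i + hy i)%:E) alpha (fun=> 0%R)
    (fun j => fy j + hy j)%R k) => // [_ _ t _|j jk].
    by rewrite -!EFinM -EFinD lee_fin -mulrDl subrK mul1r.
  by rewrite !EFinD -!fyE -!hyE; apply: min; exists j.
(* The update of v is the recursion of the averages up to sign, starting from v_1 = - z_0. *)
have -> : (- v k = \sum_(i < k) weight alpha k i *: z i)%R.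
  case: k k1 {yhatP} => // k _; elim: k => [|k IH].
    by rewrite v1 opprK big_ord1 /= alpha0 scale1r.
  by rewrite vS sum_weightS -IH scalerN opprB addrC.
apply: (jensen_weight _ alpha z fz) => //; first exact: convex_fenchel.
by move=> i _; rewrite fzE.
Qed.
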